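(* Let $d$ be an odd positive integer and let $G$ be a $d$-regular graph with girth $g(G)\geq 200d^2$. Then $G$ is strongly consistent.
   Context: All graphs are finite and simple; the girth $g(G)$ is the length of a shortest cycle (infinite if $G$ is acyclic). For a digraph $D$ (no loops, at most one edge in each direction between two vertices), $\mathrm{pn}(D)$ is the minimum number of directed paths into which the edge set of $D$ can be partitioned, and $\mathrm{ex}(D)=\frac12\sum_{v\in V(D)}|d^+(v)-d^-(v)|$. $D$ is consistent if $\mathrm{pn}(D)=\mathrm{ex}(D)$. An undirected graph $G$ is strongly consistent if every orientation of $G$ is consistent. *)

(* Defs.v *)
From mathcomp Require Import all_boot all_order all_algebra.
From mathcomp Require Import boolp constructive_ereal.

Set Implicit Arguments.
Unset Strict Implicit.
Unset Printing Implicit Defensive.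

Import Order.TTheory GRing.Theory Num.Theory.

Record sgraph (T : finType) := SGraph {
  adj :> rel T;
  adj_sym : symmetric adj;
  adj_irr : irreflexive adj }.

(* Loopless; both arcs (x, y) and (y, x) may be present. *)
Record digraph (T : finType) := DiGraph {
  arc :> rel T;
  arc_irr : irreflexive arc }.

Section Graph.
Variables (T : finType) (G : sgraph T).

Definition regular (d : nat) : Prop := forall x : T, #|[set y | G x y]| = d.

Definition has_cycle (n : nat) : bool :=
  (2 < n) && [exists c : n.-tuple T, ucycleb G c].

Definition girth : \bar int :=
  match pselect (exists n, has_cycle n) with
  | left cyc => ((ex_minn cyc)%:Z)%:E
  | right _ => +oo%E
  end.

End Graph.

Section Digraph.
Variables (T : finType) (D : digraph T).

Definition arcs : {set T * T} := [set a | D a.1 a.2].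

Definition outdeg (x : T) : nat := #|[set y | D x y]|.
Definition indeg (x : T) : nat := #|[set y | D y x]|.

(* A path is given by its sequence of vertices and has at least one arc, the
   blocks of a partition being nonempty. *)
Definition dipath (p : seq T) : bool := [&& 1 < size p, uniq p & sorted D p].

Definition path_arcs (p : seq T) : seq (T * T) := zip p (behead p).

(* As enum arcs is duplicate-free, perm_eq says that every arc of D lies on
   exactly one of the paths. *)
Definition path_partition (ps : seq (seq T)) : bool :=
  all dipath ps && perm_eq (flatten (map path_arcs ps)) (enum arcs).

Lemma path_partition_exists :
  exists k, `[< exists ps, path_partition ps /\ size ps = k >].
Proof.
pose ps := [seq [:: a.1; a.2] | a <- enum arcs].
exists (size ps); apply/asboolP; exists ps; split=> //; apply/andP; split.
  apply/allP=> _ /mapP[[x y] + ->]; rewrite mem_enum inE /= => Dxy.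
  rewrite /dipath /= inE Dxy !andbT; apply/eqP=> xy.
  by move: Dxy; rewrite xy arc_irr.
rewrite /ps -map_comp (_ : flatten _ = enum arcs) //.
by elim: (enum arcs) => //= -[x y] s ->.
Qed.

Definition pn : nat := ex_minn path_partition_exists.

Definition excess : rat :=
  (2%:R^-1 * \sum_(v : T) `|(outdeg v)%:R - (indeg v)%:R|)%R.

Definition consistent : Prop := (pn%:R = excess)%R.

End Digraph.

Definition orientation (T : finType) (G : sgraph T) (D : digraph T) : Prop :=
  forall x y : T, G x y = D x y || D y x /\ ~~ (D x y && D y x).

Definition strongly_consistent (T : finType) (G : sgraph T) : Prop :=
  forall D : digraph T, orientation G D -> consistent D.

(* Main.v *)
Require Import Defs.
From mathcomp Require Import all_boot all_order all_algebra.
From mathcomp Require Import boolp constructive_ereal.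
From mathcomp Require Import zify ring lra.

(** Let [k v] be the larger of the two degrees of [v].  Match the in-arcs of [v]
    with its out-arcs by a random cyclic shift modulo [k v]: the smaller side is
    saturated and each pair is matched with probability [1 / k v].  Following
    matched arcs cuts [D] into trails, and at each vertex only starts or only
    ends occur, so if no trail meets a vertex twice they form a partition into
    exactly [excess D] paths.

    A trail meeting [r] twice contains a directed cycle matched at all its
    vertices except possibly [r].  As [d] is odd the two degrees of a vertex
    differ.  Walking forward along a cycle of length [L], the total probability
    loses a factor [1 - 1 / k x] at each vertex [x] with fewer out-arcs than
    in-arcs; walking backward, at each of the others.  One of the two kinds makes
    up half of the cycle, so the expected number of bad cycles of length [L]
    through a vertex is at most about [L * d * (d / (d + 1)) ^ (L / 2)].

    For [L >= 200 d^2] this is small enough for a counting substitute of the local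
    lemma: let [good S] be the set of choices for which no bad cycle has all its
    matched vertices in [S].  By induction, adding a vertex to [S] multiplies
    [#|good S|] by at least [rho], since a bad cycle [y] through the new vertex
    rules out at most a fraction [\prod 1 / k] of [good (S :\: y)], which is at
    most [rho ^- size y] times as large as [good S]. *)

Set Implicit Arguments.
Unset Strict Implicit.
Unset Printing Implicit Defensive.

Import Order.TTheory GRing.Theory Num.Theory.

(** * Counting in product spaces and weighted walks *)

Lemma card_cover_le (U : finType) (I : eqType) (s : seq I) (E : {set U})
    (F : I -> {set U}) :
  (forall f, f \in E -> exists2 i, i \in s & f \in F i) ->
  #|E| <= \sum_(i <- s) #|F i|.
Proof.
elim: s E => [|i s IHs] E EF.
  rewrite big_nil leqn0 cards_eq0; apply/eqP/setP=> f; rewrite inE.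
  by apply/negP=> /EF[].
rewrite big_cons -(cardsID (F i) E); apply: leq_add.
  by apply/subset_leq_card/subsetIr.
apply: IHs => f; rewrite inE => /andP[fNi /EF[j]].
rewrite inE => /predU1P[-> fi|js fj]; first by rewrite fi in fNi.
by exists j.
Qed.

Section ProductSpace.
Variables (T X : finType).
Implicit Types (f : {ffun T -> X}) (E : {set {ffun T -> X}}).

Definition update f x s : {ffun T -> X} := [ffun z => if z == x then s else f z].

Definition independent E x := forall f s, (update f x s \in E) = (f \in E).

(** Exchanging [f x] with a free value [s] injects the pairs counted on the left into [E] times [B],
    as [E] ignores the value at [x]. *)
Lemma card_independent E x (B : {set X}) : independent E x ->
  #|[set f in E | f x \in B]| * #|X| <= #|E| * #|B|.
Proof.
move=> indE; rewrite -cardsT -!cardsX.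
pose h (q : {ffun T -> X} * X) := (update q.1 x q.2, q.1 x).
have h_inj : injective h.
  move=> [f s] [f' s'] [/ffunP eqf eqx]; congr pair.
    apply/ffunP=> z; have [->//|zx] := eqVneq z x.
    by have := eqf z; rewrite !ffunE (negPf zx).
  by have := eqf x; rewrite !ffunE eqxx.
rewrite -(card_imset _ h_inj); apply/subset_leq_card/subsetP=> q /imsetP[[f s]].
by rewrite !inE /= => /andP[/andP[fE fB] _] ->; rewrite /= indE fE.
Qed.

(** Probabilities multiply: the conditions at later vertices do not mention [x], so joined with [E]
    they stay independent of the value there. *)
Lemma card_independent_seq (k : T -> nat) (B : T -> {set X}) E (s : seq T) :
  0 < #|X| -> uniq s -> (forall x, x \in s -> independent E x) ->
  (forall x, x \in s -> #|B x| * k x <= #|X|) ->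
  #|[set f in E | all (fun x => f x \in B x) s]| * \prod_(x <- s) k x <= #|E|.
Proof.
move=> X0; elim: s => [|x s IHs] /=.
  by move=> _ _ _; rewrite big_nil muln1 subset_leq_card //;
    apply/subsetP=> f; rewrite inE => /andP[].
case/andP=> xs us indE Bk; set E' := [set f in E | all _ s] in IHs.
have {}IHs : #|E'| * \prod_(x <- s) k x <= #|E|.
  by apply: IHs => // z zs; [apply: indE|apply: Bk]; rewrite inE zs orbT.
have indE' : independent E' x.
  move=> f t; rewrite !inE indE ?mem_head //; congr andb.
  apply: eq_in_all => z zs; rewrite ffunE ifN //.
  by apply: contraNneq xs => <-.
rewrite (_ : [set f in E | _] = [set f in E' | f x \in B x]); last first.
  by apply/setP=> f; rewrite !inE; case: (f \in E); rewrite //= andbC.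
rewrite big_cons mulnA; apply: leq_trans IHs; rewrite leq_mul2r; apply/orP; right.
rewrite -(leq_pmul2r X0) mulnAC.
apply: leq_trans (leq_mul (card_independent (B x) indE') (leqnn (k x))) _.
by rewrite -mulnA leq_mul2l Bk ?orbT ?mem_head.
Qed.

End ProductSpace.

Section Walks.
Variables (T : finType) (R : rel T).

(** The start [v] is left out of each list; the walk itself is [v :: w], with [n] steps. *)
Fixpoint walks n v : seq (seq T) :=
  if n is n'.+1 then [seq x :: w | x <- enum (R v), w <- walks n' x] else [:: [::]].

Lemma mem_walks v w : path R v w -> w \in walks (size w) v.
Proof.
elim: w v => //= x w IHw v /andP[vx xw].
by apply/allpairsPdep; exists x, w; rewrite mem_enum; split=> //; apply: IHw.
Qed.

Lemma size_walks n v w : w \in walks n v -> size w = n.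
Proof.
by elim: n v w => [|n IHn] v w /=; [rewrite inE => /eqP->|case/allpairsPdep=> x [u [_ /IHn <- ->]]].
Qed.

Local Open Scope ring_scope.

(** By induction the walks from each successor of [v] weigh at most [b] in total, and [c v] times
    the number of successors is at most 1. *)
Lemma walks_weight (c : T -> rat) (b : rat) n v :
  (forall x, 0 <= c x) -> (forall x, c x <= b) ->
  (forall x, #|R x|%:R * c x <= 1) ->
  \sum_(w <- walks n v) \prod_(x <- v :: w) c x <= b.
Proof.
move=> c0 cb cR; elim: n v => [|n IHn] v /=.
  by rewrite big_seq1 big_seq1.
rewrite big_allpairs_dep /=.
under eq_bigr do under eq_bigr do rewrite big_cons.
under eq_bigr do rewrite -mulr_sumr.
rewrite -mulr_sumr.
have b0 : 0 <= b by apply: le_trans (c0 v) (cb v).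
apply: (@le_trans _ _ (c v * \sum_(x <- enum (R v)) b)).
  by apply: ler_wpM2l => //; apply: ler_sum => x _; apply: IHn.
rewrite big_const_seq count_predT iter_addr addr0 -cardE -mulr_natl mulrA.
by rewrite mulrC ler_piMr // mulrC.
Qed.

(** A marked vertex has at most [k x - 1] successors, and [(1 - 1 / k x) * (1 + 1 / d) <= 1] since
    [k x <= d]. So a reward [(d + 1) / d] per marked vertex does not make the total weight grow; 2
    bounds the weight of a single vertex. *)
Lemma walks_weight_marked (d : nat) (k : T -> nat) (m : pred T) n v :
  (forall x, 0 < k x <= d)%N -> (forall x, #|R x| + m x <= k x)%N ->
  \sum_(w <- walks n v | (n < 2 * count m (v :: w))%N)
     \prod_(x <- v :: w) (k x)%:R^-1 * (d.+1%:R / d%:R) ^+ count m (v :: w) <= 2 :> rat.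
Proof.
move=> kd Rk.
have d0 : (0 < d)%N by case/andP: (kd v); apply: leq_trans.
have d0' : 0 < d%:R :> rat by rewrite ltr0n.
pose c x : rat := (k x)%:R^-1 * (d.+1%:R / d%:R) ^+ m x.
have c0 x : 0 <= c x by rewrite mulr_ge0 ?exprn_ge0 ?divr_ge0 ?invr_ge0.
apply: le_trans (walks_weight n v c0 (b := 2) _ _).
- rewrite big_mkcond; apply: ler_sum => w _.
  have -> : \prod_(x <- v :: w) c x =
      \prod_(x <- v :: w) (k x)%:R^-1 * (d.+1%:R / d%:R) ^+ count m (v :: w).
    rewrite big_split /=; congr (_ * _).
    rewrite prodrXr; congr (_ ^+ _).
    rewrite -[RHS](sum1_count (v :: w) m) [RHS]big_mkcond.
    by apply: eq_bigr => x _; case: (m x).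
  case: ifP => // _; apply: mulr_ge0; first by apply: prodr_ge0 => x _; rewrite invr_ge0.
  by rewrite exprn_ge0 // divr_ge0.
- move=> x; rewrite /c.
  have k1 : 1 <= (k x)%:R :> rat by rewrite ler1n; case/andP: (kd x).
  have ki : (k x)%:R^-1 <= 1 :> rat by rewrite invf_le1 //; lra.
  have ki0 : 0 <= (k x)%:R^-1 :> rat by rewrite invr_ge0.
  have q2 : d.+1%:R / d%:R <= 2 :> rat by rewrite ler_pdivrMr // -natrM ler_nat; lia.
  case: (m x); rewrite ?expr1 ?expr0 ?mulr1; last lra.
  by apply: le_trans (ler_wpM2r _ ki) _; rewrite ?divr_ge0 // mul1r.
move=> x; rewrite /c; have /andP[k0 kx] := kd x; have := Rk x.
have k0' : 0 < (k x)%:R :> rat by rewrite ltr0n.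
rewrite mulrA; case: (m x); rewrite ?expr1 ?expr0 ?mulr1 ?addn0 ?addn1 => H.
  rewrite mulf_div ler_pdivrMr ?mulr_gt0 // mul1r -!natrM ler_nat.
  nia.
by rewrite ler_pdivrMr // mul1r ler_nat.
Qed.

End Walks.

(** * Numerical estimates for the decay rate *)

Section Rate.
Local Open Scope ring_scope.

(* Small enough for [d / (d + 1) <= rho d ^+ 8], yet still of order [1 / d]. *)
Definition eps (d : nat) : rat := (8 * d.+1)%:R^-1.
Definition rho (d : nat) : rat := 1 - eps d.

Lemma eps_gt0 d : 0 < eps d.
Proof. by rewrite invr_gt0 ltr0n. Qed.

Lemma eps_le d : eps d <= 8^-1.
Proof. by rewrite lef_pV2 ?posrE ?ltr0n // ler_nat; lia. Qed.

Lemma rho_gt0 d : 0 < rho d.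
Proof. have := eps_le d; rewrite /rho; lra. Qed.

Lemma rho_le1 d : rho d <= 1.
Proof. have := eps_gt0 d; rewrite /rho; lra. Qed.

(** Induction, as [(1 - e) * (1 + (n + 1) * e) <= 1 + n * e]. It lets powers of [rho d] absorb
    polynomial factors. *)
Lemma rhoX_bernoulli d n : rho d ^+ n * (1 + n%:R * eps d) <= 1.
Proof.
elim: n => [|n IHn]; first by rewrite expr0 mul1r mul0r addr0.
apply: le_trans IHn; rewrite exprSr -mulrA ler_wpM2l ?exprn_ge0 ?ltW ?rho_gt0 //.
rewrite -natr1 /rho; have := eps_gt0 d; have : 0 <= n%:R :> rat by [].
move: (n%:R) (eps d) => x e x0 e0; have := mulr_ge0 x0 (sqr_ge0 e); have := sqr_ge0 e; nra.
Qed.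

Lemma rhoX_ge d n : 1 - n%:R * eps d <= rho d ^+ n.
Proof.
elim: n => [|n IHn]; first by rewrite expr0 mul0r subr0.
rewrite exprS; apply: le_trans (ler_wpM2l (ltW (rho_gt0 d)) IHn).
rewrite -natr1 /rho; have := eps_gt0 d; have : 0 <= n%:R :> rat by [].
move: (n%:R) (eps d) => x e x0 e0; have := mulr_ge0 x0 (sqr_ge0 e); nra.
Qed.

(** Bernoulli's inequality, with [1 - 8 * eps d] exactly [d / (d + 1)]: the reward at one marked
    vertex pays for eight factors [rho d]. *)
Lemma rho8 d : (0 < d)%N -> 1 <= d.+1%:R / d%:R * rho d ^+ 8.
Proof.
move=> d0; have := rhoX_ge d 8.
have -> : 1 - 8%:R * eps d = d%:R / d.+1%:R.
  rewrite /eps natrM invfM mulrA divff // mul1r; apply/eqP.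
  by rewrite subr_eq -[X in _ + X]mul1r -mulrDl natr1 divff ?pnatr_eq0.
have d0' : 0 < d%:R :> rat by rewrite ltr0n.
by move=> H; rewrite mulrC mulrA ler_pdivlMr // mul1r -ler_pdivrMr.
Qed.

Lemma rhoX_sum d m n : eps d * \sum_(m <= i < n) rho d ^+ i <= rho d ^+ m.
Proof.
have [nm|mn] := leqP n m.
  by rewrite big_geq // mulr0 exprn_ge0 // ltW // rho_gt0.
suff : eps d * \sum_(m <= i < n) rho d ^+ i + rho d ^+ n <= rho d ^+ m.
  have : 0 <= rho d ^+ n by rewrite exprn_ge0 // ltW // rho_gt0.
  lra.
move/ltnW: mn; elim: n => [|n IHn].
  by rewrite leqn0 => /eqP->; rewrite big_geq // mulr0 add0r.
rewrite leq_eqVlt => /predU1P[<-|]; first by rewrite big_geq // mulr0 add0r.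
rewrite ltnS => mn; have := IHn mn; rewrite big_nat_recr //= exprS.
have -> : rho d * rho d ^+ n = rho d ^+ n - eps d * rho d ^+ n.
  by rewrite {1}/rho mulrBl mul1r.
lra.
Qed.

(** Of the [3 * L] factors [rho d] in the term with [L = i.+1], [L] absorb the factor [L]; the rest
    give [rho d ^+ g] times a geometric series, whose sum has order [rho d ^+ g.-1 / eps d]. *)
Lemma cycle_series d n : (0 < d)%N ->
  \sum_((200 * d ^ 2).-1 <= i < n) i.+1%:R * d%:R * rho d ^+ (3 * i.+1) * 4 <= eps d.
Proof.
move=> d0; set g := (200 * d ^ 2)%N.
have g0 : (0 < g)%N by rewrite muln_gt0 expn_gt0 d0.
have e0 := eps_gt0 d; have r0 := rho_gt0 d; have r1 := rho_le1 d.
have e0' := ltW e0; have r0' := ltW r0.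
have d0' : 1 <= d%:R :> rat by rewrite ler1n.
have bnd i : (g.-1 <= i)%N ->
  i.+1%:R * d%:R * rho d ^+ (3 * i.+1) * 4 <= 4 * d%:R / eps d * rho d ^+ g * rho d ^+ i.
  move=> gi.
  have B : i.+1%:R * rho d ^+ i.+1 <= (eps d)^-1.
    rewrite -[_^-1]mul1r ler_pdivlMr //; have := rhoX_bernoulli d i.+1.
    have : 0 <= rho d ^+ i.+1 by rewrite exprn_ge0.
    move: (rho d ^+ _) (i.+1%:R) => x y; lra.
  have C : rho d ^+ (2 * i.+1) <= rho d ^+ g * rho d ^+ i.
    by rewrite -exprD; apply: ler_wiXn2l; [exact: ltW|exact: r1|lia].
  have -> : i.+1%:R * d%:R * rho d ^+ (3 * i.+1) * 4 =
    4 * d%:R * (i.+1%:R * rho d ^+ i.+1 * rho d ^+ (2 * i.+1)).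
    have -> : (3 * i.+1 = i.+1 + 2 * i.+1)%N by lia.
    by rewrite exprD; ring.
  rewrite -!mulrA; do 2!(apply: ler_wpM2l => //).
  by rewrite mulrA; apply: ler_pM; rewrite ?mulr_ge0 ?exprn_ge0.
apply: (@le_trans _ _ (\sum_(g.-1 <= i < n) 4 * d%:R / eps d * rho d ^+ g * rho d ^+ i)).
  by rewrite big_nat_cond [leRHS]big_nat_cond; apply: ler_sum => i /andP[/andP[gi _] _]; apply: bnd.
rewrite -mulr_sumr; set Sm := \sum_(_ <= _ < _) _.
have HS : Sm <= rho d ^+ g.-1 / eps d by rewrite ler_pdivlMr // mulrC rhoX_sum.
(* Chosen so that [32 * 12 * d ^ 2 <= 2 * g - 1] and [12 * d ^ 2 * eps d >= 3 / 4 * d]. *)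
pose b := rho d ^+ (12 * d ^ 2).
have a0 : 0 <= b by rewrite exprn_ge0.
have b_ge : b * (1 + 3 / 4 * d%:R) <= 1.
  apply: le_trans (rhoX_bernoulli d (12 * d ^ 2)); apply: ler_wpM2l => //.
  rewrite lerD2l /eps ler_pdivlMr ?ltr0n // !natrM -(natr1 d).
  have := d0'; move: (d%:R) => x x1; nra.
have ag : rho d ^+ g * rho d ^+ g.-1 <= b ^+ 32.
  by rewrite -exprD -exprM; apply: ler_wiXn2l; [exact: ltW|exact: r1|lia].
have b47 : b <= 4 / 7 by rewrite ler_pdivlMr //; nra.
have bd : b * d%:R <= 4 / 3 by nra.
have eE : (eps d)^-1 = 8 * (d%:R + 1) by rewrite /eps invrK natrM natr1.
apply: (@le_trans _ _ (4 * d%:R / eps d * rho d ^+ g * (rho d ^+ g.-1 / eps d))).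
  by apply: ler_wpM2l => //; rewrite !mulr_ge0 ?invr_ge0 ?exprn_ge0.
have -> : 4 * d%:R / eps d * rho d ^+ g * (rho d ^+ g.-1 / eps d) =
  eps d * (4 * d%:R * ((eps d)^-1 ^+ 3 * (rho d ^+ g * rho d ^+ g.-1))).
  by field; rewrite lt0r_neq0.
rewrite -[leRHS]mulr1; apply: ler_wpM2l; first exact: ltW.
apply: (@le_trans _ _ (4 * d%:R * ((16 * d%:R) ^+ 3 * b ^+ 32))).
  apply: ler_wpM2l; first by rewrite mulr_ge0.
  apply: ler_pM; [by rewrite exprn_ge0 ?invr_ge0|by rewrite mulr_ge0 ?exprn_ge0| |exact: ag].
  by rewrite eE; apply: lerXn2r; rewrite ?nnegrE; lra.
(* As [4 * 16 ^ 3 = 4 ^ 7], four powers of [b] go against [d ^ 4] and the other 28 against the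
   constant. *)
have -> : 4 * d%:R * ((16 * d%:R) ^+ 3 * b ^+ 32) = (b * d%:R) ^+ 4 * (4 * b ^+ 4) ^+ 7.
  by ring.
have bd0 : 0 <= b * d%:R by rewrite mulr_ge0.
have bd4 : (b * d%:R) ^+ 4 <= 4.
  have H : (b * d%:R) ^+ 2 <= 2 by nra.
  by have := sqr_ge0 (b * d%:R); rewrite (exprM _ 2 2); nra.
have b4 : 4 * b ^+ 4 <= 2^-1.
  have H : b ^+ 2 <= 3^-1 by nra.
  by have := sqr_ge0 b; rewrite (exprM _ 2 2); nra.
have b40 : 0 <= 4 * b ^+ 4 by rewrite mulr_ge0 ?exprn_ge0.
apply: (@le_trans _ _ (4 * 2^-1 ^+ 7)); last lra.
apply: ler_pM => //; rewrite ?exprn_ge0 //.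
by apply: lerXn2r; rewrite ?nnegrE.
Qed.

End Rate.

(** * Choices without bad cycles *)

Section OneDirection.
Variables (T X : finType) (d : nat) (k : T -> nat).
Hypotheses (X_gt0 : 0 < #|X|) (k_bnd : forall x, 0 < k x <= d).
Variables (R : rel T) (mt : T -> X -> rel T) (m : pred T).
Hypothesis mt_card : forall x u w, #|[set s | mt x s u w]| * k x <= #|X|.
Hypothesis R_card : forall x, #|R x| + m x <= k x.

Local Open Scope ring_scope.

(** Union bound over the cycles [y = v :: w] and their exceptional vertices [r]. The matchings at
    the other vertices of [y] are independent of [E (S :\: y)], which is then compared with [E S].
    Keeping [R], [mt] and [m] abstract covers both walking directions. *)
Lemma card_one_direction (E : {set T} -> {set {ffun T -> X}}) (S : {set T}) (v : T)
    (F : {set {ffun T -> X}}) :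
  (forall (S' : {set T}) x, x \notin S' -> independent (E S') x) ->
  (forall y : seq T, uniq y -> rho d ^+ size y * #|E (S :\: [set x in y])|%:R <= #|E S|%:R) ->
  (forall f, f \in F -> exists w r,
    [/\ [/\ uniq (v :: w), path R v w & r \in w],
        (200 * d ^ 2 <= size (v :: w) <= 2 * count m (v :: w))%N,
        f \in E (S :\: [set x in v :: w]) &
        forall x, x \in v :: w -> x != r ->
          mt x (f x) (prev (v :: w) x) (next (v :: w) x)]) ->
  #|F|%:R <= eps d / 2 * #|E S|%:R.
Proof.
move=> indE Erho FP.
have d0 : (0 < d)%N by case/andP: (k_bnd v); apply: leq_trans.
pose P w := uniq (v :: w) && (size w < 2 * count m (v :: w))%N.
(* A cycle on [i.+1] vertices is a walk of [i] steps, hence the predecessor; distinctness of its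
   vertices bounds [i] by [#|T|]. *)
pose ws := flatten [seq [seq w <- walks R i v | P w] | i <- index_iota (200 * d ^ 2).-1 #|T|].
pose B (w : seq T) x := [set s | mt x s (prev (v :: w) x) (next (v :: w) x)].
pose H w r := [set f in E (S :\: [set x in v :: w]) |
  all (fun x => f x \in B w x) (rem r (v :: w))].
pose I := [seq (w, r) | w <- ws, r <- w].
have le1 : (#|F| <= \sum_(i <- I) #|H i.1 i.2|)%N.
  apply: card_cover_le => f /FP[w [r [[uw pw rw] /andP[gw mw] fE fm]]].
  exists (w, r).
    apply/allpairsPdep; exists w, r; split=> //.
    apply/flattenP; exists [seq w <- walks R (size w) v | P w]; last first.
      by rewrite mem_filter mem_walks // andbT /P uw.
    apply/mapP; exists (size w) => //; rewrite mem_index_iota.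
    have /= := max_card (mem (v :: w)); rewrite (card_uniqP uw) => ->.
    by rewrite andbT -ltnS prednK // muln_gt0 expn_gt0 d0.
  change (f \in H w r); rewrite inE fE; apply/allP=> x.
  by rewrite (mem_rem_uniq r uw) !inE => /andP[xr xw]; apply: fm.
have r0 := rho_gt0 d.
(* No factor [1 / k r] is gained at [r]; inserting it costs [k r <= d] and completes the product
   over the walk. *)
have le2 w r : P w -> r \in w -> #|H w r|%:R <=
    #|E S|%:R * d%:R * (rho d ^- size (v :: w) * \prod_(x <- v :: w) (k x)%:R^-1).
  case/andP=> uw _ rw.
  have rw' : r \in v :: w by rewrite inE rw orbT.
  have le3 : (#|H w r| * \prod_(x <- rem r (v :: w)) k x <= #|E (S :\: [set x in v :: w])|)%N.
    apply: card_independent_seq => // [|x xw|x _]; [by rewrite rem_uniq| |exact: mt_card].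
    by apply: indE; rewrite inE negb_and negbK inE (mem_rem xw).
  rewrite -(ler_nat rat) natrM natr_prod in le3.
  have K0 : 0 < \prod_(x <- rem r (v :: w)) (k x)%:R :> rat.
    by apply: prodr_gt0 => x _; rewrite ltr0n; case/andP: (k_bnd x).
  have p0 : 0 < rho d ^+ size (v :: w) by rewrite exprn_gt0.
  rewrite (perm_big _ (perm_to_rem rw')) big_cons prodfV.
  have /andP[kr0 krd] := k_bnd r.
  have kr0' : 0 < (k r)%:R :> rat by rewrite ltr0n.
  have dk : 1 <= d%:R / (k r)%:R :> rat by rewrite ler_pdivlMr // mul1r ler_nat.
  apply: (@le_trans _ _ (#|E S|%:R / rho d ^+ size (v :: w) /
    \prod_(x <- rem r (v :: w)) (k x)%:R)).
    rewrite ler_pdivlMr //; apply: le_trans le3 _.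
    by rewrite ler_pdivlMr // mulrC Erho.
  rewrite [leRHS](_ : _ = #|E S|%:R / rho d ^+ size (v :: w) /
    \prod_(x <- rem r (v :: w)) (k x)%:R * (d%:R / (k r)%:R)); last first.
    move: (rho d ^+ _) (\prod_(i <- _) _) => p q; rewrite /=; ring.
  by rewrite ler_peMr // !mulr_ge0 // invr_ge0 ltW.
have le4 i : \sum_(w <- walks R i v | P w) (\sum_(r <- w) #|H w r|)%:R <=
    #|E S|%:R / 2 * (i.+1%:R * d%:R * rho d ^+ (3 * i.+1) * 4).
  pose Q (w : seq T) : rat := \prod_(x <- v :: w) (k x)%:R^-1.
  have Q0 w : 0 <= Q w by apply: prodr_ge0 => x _; rewrite invr_ge0.
  pose c := #|E S|%:R * d%:R * rho d ^- i.+1 * i.+1%:R.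
  have c0 : 0 <= c by rewrite !mulr_ge0 // invr_ge0 exprn_ge0 // ltW.
  apply: (@le_trans _ _ (\sum_(w <- walks R i v | P w) c * Q w)).
    rewrite big_seq_cond [leRHS]big_seq_cond; apply: ler_sum => w /andP[/size_walks szw Pw].
    apply: (@le_trans _ _ (\sum_(r <- w) (#|E S|%:R * d%:R * rho d ^- i.+1 * Q w))).
      rewrite natr_sum big_seq_cond [leRHS]big_seq_cond; apply: ler_sum => r; rewrite andbT => rw.
      by apply: le_trans (le2 w r Pw rw) _; rewrite /= szw mulrA.
    rewrite big_const_seq count_predT iter_addr addr0 szw -[leLHS]mulr_natr /c.
    rewrite [leRHS](_ : _ = #|E S|%:R * d%:R / rho d ^+ i.+1 * Q w * i.+1%:R); last by ring.
    by apply: ler_wpM2l; rewrite ?ler_nat // !mulr_ge0 // invr_ge0 exprn_ge0 // ltW.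
  rewrite -mulr_sumr.
  (* At least half of the [i.+1] vertices are marked, each with a reward of at least
     [rho d ^- 8]. *)
  have le5 : \sum_(w <- walks R i v | P w) Q w <= 2 * rho d ^+ (4 * i.+1).
    have := walks_weight_marked i v k_bnd R_card.
    move=> /(ler_wpM2r (exprn_ge0 (4 * i.+1) (ltW r0))); apply: le_trans.
    rewrite mulr_suml big_seq_cond [leRHS]big_seq_cond big_mkcond [leRHS]big_mkcond.
    apply: ler_sum => w _.
    case: ifP => [/andP[wi /andP[uw mw]]|_]; last first.
      case: ifP => // _; apply: mulr_ge0; last by rewrite exprn_ge0 // ltW.
      by apply: mulr_ge0; [exact: Q0|rewrite exprn_ge0 ?divr_ge0].
    have szw := size_walks wi.
    rewrite wi -{1}szw mw -mulrA ler_peMr //.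
    apply: (@le_trans _ _ ((d.+1%:R / d%:R * rho d ^+ 8) ^+ count m (v :: w))).
      by rewrite exprn_ege1 // rho8.
    rewrite exprMn -exprM; apply: ler_wpM2l; first by rewrite exprn_ge0 ?divr_ge0.
    by apply: ler_wiXn2l; [exact: ltW|exact: rho_le1|];
      move: mw; rewrite szw; move: (count _ _) => j; lia.
  apply: le_trans (ler_wpM2l c0 le5) _; rewrite /c.
  have -> : (4 * i.+1 = i.+1 + 3 * i.+1)%N by lia.
  rewrite exprD; have /lt0r_neq0 := exprn_gt0 i.+1 r0.
  by move: (rho d ^+ i.+1) (rho d ^+ _) => p q p0;
    rewrite le_eqVlt; apply/orP; left; apply/eqP; field.
have : #|F|%:R <= (\sum_(i <- I) #|H i.1 i.2|)%:R :> rat by rewrite ler_nat.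
move/le_trans; apply.
rewrite /I big_allpairs_dep big_flatten big_map /= natr_sum.
under eq_bigr do rewrite big_filter natr_sum.
apply: (@le_trans _ _ (\sum_((200 * d ^ 2).-1 <= i < #|T|) #|E S|%:R / 2 *
   (i.+1%:R * d%:R * rho d ^+ (3 * i.+1) * 4))).
  by apply: ler_sum => i _; apply: le4.
rewrite -mulr_sumr [leRHS](_ : _ = #|E S|%:R / 2 * eps d); last by ring.
by apply: ler_wpM2l; rewrite ?divr_ge0 // cycle_series.
Qed.
End OneDirection.

Section GoodConfiguration.
Variables (T X : finType) (d : nat) (k : T -> nat).
Hypotheses (X_gt0 : 0 < #|X|) (d_gt0 : 0 < d) (k_bnd : forall x, 0 < k x <= d).
Variables (R : rel T) (mt : T -> X -> rel T).
Hypothesis mt_card : forall x u w, #|[set s | mt x s u w]| * k x <= #|X|.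
Hypothesis R_out : forall x, #|R x| <= k x.
(** Where forward walks lose nothing, backward walks must lose a factor. *)
Hypothesis R_in : forall x, #|[pred y | R y x]| + (#|R x| == k x) <= k x.

(* [y] is visited cyclically and [r] is the vertex at which a trail may close up
   without its arcs there being matched. *)
Definition bad (S : {set T}) (f : {ffun T -> X}) (y : seq T) (r : T) : Prop :=
  [/\ uniq y, cycle R y, r \in y, 200 * d ^ 2 <= size y &
   forall x, x \in y -> x != r -> x \in S /\ mt x (f x) (prev y x) (next y x)].

Definition good (S : {set T}) : {set {ffun T -> X}} :=
  [set f | `[< forall y r, ~ bad S f y r >]].

Lemma goodP S f : reflect (forall y r, ~ bad S f y r) (f \in good S).
Proof. by rewrite inE; apply: asboolP. Qed.

Lemma good_sub (S S' : {set T}) f : S \subset S' -> f \in good S' -> f \in good S.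
Proof.
move=> /subsetP sub /goodP gf; apply/goodP=> y r [uy cy ry gy by_]; apply: (gf y r).
by split=> // x xy xr; have [/sub] := by_ x xy xr.
Qed.

Lemma good_independent (S : {set T}) x : x \notin S -> independent (good S) x.
Proof.
move=> xS f s; suff eqb y r : bad S (update f x s) y r <-> bad S f y r.
  by apply/goodP/goodP=> gf y r /eqb /gf.
split=> -[uy cy ry gy by_]; split=> // z zy zr; have [zS] := by_ z zy zr.
  by rewrite ffunE ifN //; apply: contraNneq xS => <-.
by rewrite ffunE ifN //; apply: contraNneq xS => <-.
Qed.

Local Open Scope ring_scope.

(** The vertices of [y] leave [S] one at a time; one outside [S] only wastes a factor [rho d <= 1].
    The first hypothesis leaves room for the induction hypothesis of [good_extend]. *)
Lemma good_remove n (S : {set T}) (y : seq T) :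
  (forall (S' : {set T}) v, (#|S'| < n)%N -> v \notin S' ->
     rho d * #|good S'|%:R <= #|good (v |: S')|%:R) ->
  (#|S| <= n)%N ->
  rho d ^+ size y * #|good (S :\: [set x in y])|%:R <= #|good S|%:R.
Proof.
move=> step Sn; elim: y => [|x y IHy] /=.
  by rewrite expr0 mul1r (_ : _ :\: _ = S) //; apply/setP=> z; rewrite !inE.
apply: le_trans IHy; rewrite exprSr -mulrA.
apply: ler_wpM2l; first by rewrite exprn_ge0 // ltW // rho_gt0.
have [xS|xS] := boolP (x \in S :\: [set z in y]); last first.
  rewrite (_ : S :\: [set z in x :: y] = S :\: [set z in y]); last first.
    apply/setP=> z; rewrite !inE; have [->|//] := eqVneq z x.
    by move: xS; rewrite !inE; case: (x \in y); case: (x \in S).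
  by rewrite ler_piMl // rho_le1.
have eqS : S :\: [set z in y] = x |: (S :\: [set z in x :: y]).
  apply/setP=> z; rewrite !inE; have [->|//] := eqVneq z x.
  by move: xS; rewrite !inE => ->.
have xN : x \notin S :\: [set z in x :: y] by rewrite !inE eqxx.
rewrite eqS; apply: step => //; apply: leq_trans Sn.
apply: leq_trans (_ : #|S :\: [set z in y]| <= _)%N; last exact/subset_leq_card/subsetDl.
by rewrite eqS cardsU1 xN.
Qed.

(** A choice lost by adding [v] has a bad cycle through [v], at least half of it in [m] or in its
    complement. Each of the two cases takes at most a fraction [eps d / 2] of [good S]. *)
Lemma good_extend (S : {set T}) v : v \notin S ->
  rho d * #|good S|%:R <= #|good (v |: S)|%:R.
Proof.
have [n] := ubnP #|S|; elim: n => // n IHn in S v *; rewrite ltnS => Sn vS.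
have rem_y (y : seq T) : uniq y ->
    rho d ^+ size y * #|good (S :\: [set x in y])|%:R <= #|good S|%:R.
  by move=> _; apply: good_remove Sn => S' u; apply: IHn.
(* The vertices where forward walks lose a factor; at the others backward walks do. *)
pose m x := #|R x| != k x.
pose F (m' : pred T) := [set f in good S | `[< exists y r, bad (v |: S) f (v :: y) r /\
    (size (v :: y) <= 2 * count m' (v :: y))%N >]].
have FP m' f : f \in F m' -> exists y r,
    [/\ bad (v |: S) f (v :: y) r, (size (v :: y) <= 2 * count m' (v :: y))%N,
        r \in y & f \in good (S :\: [set x in v :: y])].
  rewrite inE => /andP[fS /asboolP[y [r [b le_m]]]]; exists y, r; split=> //.
    (* If [r = v], nothing is required at the new vertex, so the cycle is already bad for [S]. *)
    case: (b) => uy cy; rewrite inE => /predU1P[rv|//] gy by_.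
    have/goodP/(_ (v :: y) r) := fS; case; split=> // [|x xy xr]; first by rewrite rv mem_head.
    have [xS mx] := by_ x xy xr; split=> //.
    by move: xS; rewrite !inE -rv (negPf xr).
  by apply: good_sub fS; apply: subsetDl.
have F1 : #|F m|%:R <= eps d / 2 * #|good S|%:R.
  apply: (@card_one_direction _ _ _ _ X_gt0 k_bnd R mt m mt_card _ good S v) => //.
  - by move=> x; rewrite /m; have := R_out x; case: ltngtP => //=; lia.
  - exact: good_independent.
  move=> f /FP[y [r [[uy cy ry gy by_] le_m ry' fG]]]; exists y, r; split=> //.
  - by split=> //; move: cy; rewrite /= rcons_path => /andP[].
  - by rewrite gy.
  by move=> x xy xr; have [] := by_ x xy xr.
(* The same count for the converse relation and the reversed cycle, where [prev] and [next] swap. *)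
have F2 : #|F (predC m)|%:R <= eps d / 2 * #|good S|%:R.
  apply: (@card_one_direction _ _ _ _ X_gt0 k_bnd (fun x y => R y x)
    (fun x s u w => mt x s w u) (predC m)
    (fun x u w => mt_card x w u) _ good S v) => //.
  - by move=> x; rewrite /m /= negbK; apply: R_in.
  - exact: good_independent.
  move=> f /FP[y [r [[uy cy ry gy by_] le_m ry' fG]]]; exists (rev y), r.
  have rE : v :: rev y = rotr 1 (rev (v :: y)) by rewrite rev_cons rotr1_rcons.
  have ur : uniq (rev (v :: y)) by rewrite rev_uniq.
  have memr : v :: rev y =i v :: y by move=> z; rewrite !inE mem_rev.
  split=> //.
  - split; [by rewrite rE rotr_uniq| |by rewrite mem_rev].
    have : cycle (fun x y => R y x) (v :: rev y) by rewrite rE rotr_cycle rev_cycle.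
    by rewrite /= rcons_path => /andP[].
  - by rewrite /= size_rev count_rev gy.
  - by rewrite (_ : [set x in _] = [set x in v :: y]) //; apply/setP=> z; rewrite !inE mem_rev.
  move=> x; rewrite memr => xy xr; have [] := by_ x xy xr.
  by rewrite rE next_rotr // prev_rotr // next_rev // prev_rev.
have cover : (#|good S| <= #|good (v |: S)| + (#|F m| + #|F (predC m)|))%N.
  rewrite -(cardsID (good (v |: S)) (good S)); apply: leq_add.
    exact/subset_leq_card/subsetIr.
  rewrite -cardsUI; apply: leq_trans (leq_addr _ _); apply/subset_leq_card/subsetP=> f.
  rewrite inE => /andP[fN fS].
  have [y [r b]] : exists y r, bad (v |: S) f y r.
    by move: fN; rewrite inE => /asboolPn/existsNP[y /existsNP[r /contrapT b]]; exists y, r.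
  case: (b) => uy cy ry gy by_.
  have vy : v \in y.
    apply/negP=> /negP vy; have/goodP/(_ y r) := fS; case; split=> // x xy xr.
    have [xS mx] := by_ x xy xr; split=> //; move: xS; rewrite !inE.
    by case: eqVneq => // xv; rewrite -xv xy in vy.
  have [i w yw] := rot_to vy.
  have b' : bad (v |: S) f (v :: w) r.
    rewrite -yw; split; rewrite ?rot_uniq ?rot_cycle ?mem_rot ?size_rot //.
    by move=> x; rewrite mem_rot => xy xr; rewrite prev_rot // next_rot //; apply: by_.
  have := count_predC m (v :: w) => cnt.
  have fF m' : (size (v :: w) <= 2 * count m' (v :: w))%N -> f \in F m'.
    by move=> le_m; rewrite inE fS; apply/asboolP; exists w, r.
  rewrite in_setU; have [/fF->//|le_m] := leqP (size (v :: w)) (2 * count m (v :: w))%N.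
  by rewrite (fF (predC m)) ?orbT //; lia.
have := cover; rewrite -(ler_nat rat) !natrD /rho mulrBl mul1r; lra.
Qed.

Lemma good_configuration : exists f, forall y r, uniq y -> cycle R y -> r \in y ->
  (200 * d ^ 2 <= size y)%N ->
  exists x, [/\ x \in y, x != r & ~~ mt x (f x) (prev y x) (next y x)].
Proof.
have : 0 < #|good setT|%:R :> rat.
  (* For the empty set every choice is good: a cycle this long has a vertex other than [r], which
     would have to lie in that set. *)
  apply: lt_le_trans (@good_remove #|T| setT (enum T) _ _).
  - rewrite mulr_gt0 ?exprn_gt0 ?rho_gt0 // ltr0n; apply/card_gt0P.
    have /card_gt0P[s _] := X_gt0; exists [ffun=> s]; apply/goodP=> y r [uy cy ry gy by_].
    suff [x [xy xr]] : exists x, x \in y /\ x != r by have [] := by_ x xy xr; rewrite !inE mem_enum.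
    apply/not_existsP=> no; have : (size y <= 1)%N.
      rewrite -(card_uniqP uy) -(card1 r); apply/subset_leq_card/subsetP=> x xy.
      by apply/negPn/negP=> xr; apply: (no x).
    nia.
  - by move=> S' v _; apply: good_extend.
  - by rewrite cardsT.
rewrite ltr0n => /card_gt0P[f /goodP gf]; exists f => y r uy cy ry gy.
apply/not_existsP=> no; apply: (gf y r); split=> // x xy xr; split; first by rewrite inE.
by apply/negPn/negP=> nm; apply: (no x).
Qed.
End GoodConfiguration.

(** * Matching by cyclic shifts *)

Section ShiftMatching.
Variables (T : finType) (R : rel T) (N : nat).

Definition ins v := enum [pred u | R u v].
Definition outs v := enum (R v).
Definition degmax v := maxn (size (ins v)) (size (outs v)).

(* [degmax v] divides [N] in all uses, so that a uniform [s] is a uniform shift. *)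
Definition shift_mate v (s : 'I_N) u w :=
  [&& R u v, R v w & (index u (ins v) + s) %% degmax v == index w (outs v)].

Lemma mem_ins v u : (u \in ins v) = R u v.
Proof. by rewrite mem_enum. Qed.

Lemma mem_outs v w : (w \in outs v) = R v w.
Proof. by rewrite mem_enum. Qed.

Lemma index_ins v u : R u v -> index u (ins v) < degmax v.
Proof.
by rewrite -mem_ins -index_mem => /leq_trans; apply; apply: leq_maxl.
Qed.

(** [u] and [w] determine [s] modulo [degmax v], and its quotient has [N / degmax v] possible
    values. *)
Lemma shift_mate_card v u w : 0 < degmax v -> degmax v %| N ->
  #|[set s | shift_mate v s u w]| * degmax v <= N.
Proof.
move=> k0 /dvdnP[m defN]; rewrite [leqRHS]defN leq_mul2r; apply/orP; right.
have lt_m (s : 'I_N) : s %/ degmax v < m by rewrite ltn_divLR // -defN.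
pose h s : 'I_m := Ordinal (lt_m s).
rewrite -[m]card_ord -(card_in_imset (f := h)) ?max_card //.
move=> s s'; rewrite !inE => /and3P[_ _ /eqP es] /and3P[_ _ /eqP es'] /(congr1 val) /= eqh.
apply/val_inj => /=; rewrite (divn_eq s (degmax v)) eqh [RHS](divn_eq s' (degmax v)).
congr (_ + _); apply/eqP; rewrite -(eqn_modDl (index u (ins v))).
by rewrite es es'.
Qed.

Lemma shift_mate_fun v s u w w' : shift_mate v s u w -> shift_mate v s u w' -> w = w'.
Proof.
case/and3P=> _ vw /eqP e /and3P[_ vw' /eqP e'].
by apply: (@index_inj _ u (outs v)); rewrite ?mem_outs // -e.
Qed.

Lemma shift_mate_inj v s u u' w : shift_mate v s u w -> shift_mate v s u' w -> u = u'.
Proof.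
case/and3P=> uv _ /eqP e /and3P[uv' _ /eqP e'].
apply: (@index_inj _ w (ins v)); rewrite ?mem_ins //.
have /eqP : index u (ins v) + s == index u' (ins v) + s %[mod degmax v] by rewrite e e'.
by move/eqP; rewrite eqn_modDr !modn_small ?index_ins // => /eqP.
Qed.

(** The shift permutes the residues modulo [degmax v], and the longer list occupies all of them, so
    each vertex of the shorter one has a partner. *)
Lemma shift_mate_saturated v s u w : R u v -> R v w ->
  (exists w', shift_mate v s u w') \/ (exists u', shift_mate v s u' w).
Proof.
move=> uv vw; have k0 : 0 < degmax v by apply: leq_ltn_trans (index_ins uv).
have [io|oi] := leqP (size (ins v)) (size (outs v)).
  left; pose j := (index u (ins v) + s) %% degmax v.
  have jo : j < size (outs v).
    by apply: leq_trans (ltn_pmod _ k0) _; rewrite /degmax (maxn_idPr io).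
  exists (nth u (outs v) j); rewrite /shift_mate uv -mem_outs mem_nth //=.
  by rewrite index_uniq ?enum_uniq.
right; pose i := (index w (outs v) + (degmax v - s %% degmax v)) %% degmax v.
have ii : i < size (ins v).
  by apply: leq_trans (ltn_pmod _ k0) _; rewrite /degmax (maxn_idPl (ltnW oi)).
exists (nth u (ins v) i); rewrite /shift_mate -mem_ins mem_nth //= vw.
have lts := ltn_pmod s k0.
rewrite index_uniq ?enum_uniq // /i modnDml -addnA -modnDmr -(modnDmr _ s).
rewrite subnK 1?ltnW // modnn addn0 modn_small ?eqxx //.
have : index w (outs v) < size (outs v) by rewrite index_mem mem_outs.
by move/leq_trans; apply; apply: leq_maxr.
Qed.

End ShiftMatching.

(** * Path partitions and excess *)

Section Excess.
Variables (T : finType) (D : digraph T).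
Implicit Types (p : seq T) (ps : seq (seq T)) (v : T).

(* On a nonempty [p] the default value [v] plays no role. *)
Definition starts ps v := count (fun p => head v p == v) ps.
Definition ends ps v := count (fun p => last v p == v) ps.

Lemma outdeg_count v : outdeg D v = count (fun a => a.1 == v) (enum (arcs D)).
Proof.
rewrite -sum1_count big_enum_cond sum1dep_card /outdeg.
have pair_inj : injective (fun y : T => (v, y)) by move=> y y' [].
rewrite -(card_imset _ pair_inj); apply: eq_card => -[x y]; rewrite !inE /=.
apply/imsetP/andP=> [[z]|[Dxy /eqP xv]]; first by rewrite inE => Dvz [-> ->].
by exists y; rewrite -xv ?inE.
Qed.

Lemma indeg_count v : indeg D v = count (fun a => a.2 == v) (enum (arcs D)).
Proof.
rewrite -sum1_count big_enum_cond sum1dep_card /indeg.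
have pair_inj : injective (fun y : T => (y, v)) by move=> y y' [].
rewrite -(card_imset _ pair_inj); apply: eq_card => -[x y]; rewrite !inE /=.
apply/imsetP/andP=> [[z]|[Dxy /eqP yv]]; first by rewrite inE => Dvz [-> ->].
by exists x; rewrite -yv ?inE.
Qed.

Lemma path_arcs_balance p v : 1 < size p ->
  count (fun a => a.1 == v) (path_arcs p) + (last v p == v) =
  count (fun a => a.2 == v) (path_arcs p) + (head v p == v).
Proof.
case: p => // x p _; rewrite /path_arcs /=.
have -> : count (fun a => a.2 == v) (zip (x :: p) p) = count_mem v p.
  by elim: p x => //= y p IHp x; rewrite IHp.
rewrite addnC [RHS]addnC; elim: p x => [|y p IHp] x /=; first by rewrite addn0.
by rewrite addnCA IHp.
Qed.

Lemma balance ps v : path_partition D ps ->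
  outdeg D v + ends ps v = indeg D v + starts ps v.
Proof.
case/andP=> /allP dips /permP cnt; rewrite outdeg_count indeg_count -!cnt {cnt}.
elim: ps dips => //= p ps IHps dips; rewrite !count_cat.
have /path_arcs_balance : 1 < size p by have /and3P[] := dips p (mem_head _ _).
move=> /(_ v); rewrite /starts /ends /= in IHps *.
have := IHps (fun q qs => dips q (mem_behead (s := p :: ps) qs)); lia.
Qed.

Lemma sum_starts_ends ps : path_partition D ps ->
  \sum_v starts ps v = size ps /\ \sum_v ends ps v = size ps.
Proof.
case/andP=> /allP dips _; have {dips} : forall p, p \in ps -> p != [::].
  by move=> p /dips/and3P[]; case: p.
elim: ps => [|p ps IHps] np /=; first by rewrite /starts /ends /= !big1.
have [|s e] := IHps; first by move=> q qs; apply: np; rewrite inE qs orbT.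
rewrite /starts /ends /= !big_split /= -/(starts ps) -/(ends ps).
rewrite -[X in _ + X = _]/(\sum_v starts ps v) -[X in _ /\ _ + X = _]/(\sum_v ends ps v) s e.
have sum1 z : \sum_(v : T) (z == v) = 1.
  by rewrite (bigD1 z) //= eqxx big1 // => v; rewrite eq_sym => /negPf->.
by case: p np => [/(_ _ (mem_head _ _))//|x p _]; rewrite !sum1.
Qed.

Local Open Scope ring_scope.

(** By [balance] each degree difference is [starts - ends], of absolute value at most
    [starts + ends]; both sum to [size ps]. Equality holds once one of the two vanishes at every
    vertex. *)
Lemma excess_le ps : path_partition D ps -> excess D <= (size ps)%:R.
Proof.
move=> part; have [s e] := sum_starts_ends part.
suff : \sum_v `|(outdeg D v)%:R - (indeg D v)%:R| <= (size ps)%:R + (size ps)%:R :> rat.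
  by rewrite /excess; lra.
rewrite -{1}s -e !natr_sum -big_split; apply: ler_sum => v _ /=.
have := congr1 (fun n => n%:R : rat) (balance v part); rewrite !natrD => bal.
have : 0 <= (starts ps v)%:R :> rat by []. have : 0 <= (ends ps v)%:R :> rat by [].
rewrite ler_norml; lra.
Qed.

Lemma excess_eq ps : path_partition D ps ->
  (forall v, starts ps v = 0%N \/ ends ps v = 0%N) -> excess D = (size ps)%:R.
Proof.
move=> part noth; have [s e] := sum_starts_ends part.
suff : \sum_v `|(outdeg D v)%:R - (indeg D v)%:R| = (size ps)%:R + (size ps)%:R :> rat.
  by rewrite /excess => ->; field.
rewrite -{1}s -e !natr_sum -big_split; apply: eq_bigr => v _ /=.
have := congr1 (fun n => n%:R : rat) (balance v part); rewrite !natrD.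
have [->|->] := noth v; rewrite mulr0n ?addr0 ?add0r => bal.
  rewrite (_ : _ - _ = - (ends ps v)%:R) ?normrN ?normr_nat //; lra.
rewrite (_ : _ - _ = (starts ps v)%:R) ?normr_nat //; lra.
Qed.

Lemma consistent_witness ps : path_partition D ps ->
  (forall v, starts ps v = 0%N \/ ends ps v = 0%N) -> consistent D.
Proof.
move=> part noth; rewrite /consistent /pn; case: ex_minnP => m /asboolP[qs [qpart <-]] min.
apply/le_anti/andP; split; last exact: excess_le.
by rewrite (excess_eq part noth) ler_nat min //; apply/asboolP; exists ps.
Qed.

End Excess.

(** * Merging matched arcs into trails *)

Lemma sorted_adjacent (U : Type) (e : rel U) s1 x y s2 :
  sorted e (s1 ++ x :: y :: s2) -> e x y.
Proof. by case: s1 => [|z s1] /=; rewrite ?cat_path /=; [case/andP|case/and4P]. Qed.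

Lemma uniq_last_adjacent (U : eqType) (t s1 s2 : seq U) x y :
  uniq (rcons t x) -> rcons t x <> s1 ++ x :: y :: s2.
Proof.
move=> + eqt; rewrite eqt cat_uniq => /and3P[_ _ /andP[/negP nx _]]; apply: nx.
by have := congr1 (last x) eqt; rewrite last_rcons last_cat /= => {1}->; apply: mem_last.
Qed.

Lemma uniq_head_adjacent (U : eqType) (t s1 s2 : seq U) x y :
  uniq (y :: t) -> y :: t <> s1 ++ x :: y :: s2.
Proof.
move=> + eqt; case: s1 eqt => [|z s1] [-> ->] /andP[/negP nx _]; apply: nx.
  by rewrite mem_head.
by rewrite mem_cat !inE eqxx !orbT.
Qed.

Section Trails.
Variables (T : finType) (D : digraph T) (mate : T -> rel T).
Implicit Types (a b : T * T) (t : seq (T * T)) (ts : seq (seq (T * T))).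
Hypothesis mate_arc : forall v u w, mate v u w -> D u v && D v w.
Hypothesis mate_fun : forall v u w w', mate v u w -> mate v u w' -> w = w'.
Hypothesis mate_inj : forall v u u' w, mate v u w -> mate v u' w -> u = u'.
Hypothesis mate_saturated : forall v u w, D u v -> D v w ->
  (exists w', mate v u w') \/ (exists u', mate v u' w).

Definition follows a b := (a.2 == b.1) && mate a.2 a.1 b.2.

Definition verts t := if t is a :: t' then a.1 :: map snd t else [::].

Hypothesis trail_uniq : forall t, all (mem (arcs D)) t -> sorted follows t -> uniq (verts t).

Definition trail_family ts :=
  all (fun t => (t != [::]) && sorted follows t) ts && perm_eq (flatten ts) (enum (arcs D)).

Definition mergeable ts := exists t t' a b,
  [/\ rcons t a \in ts, b :: t' \in ts & follows a b].

Lemma path_arcs_verts t : sorted follows t -> path_arcs (verts t) = t.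
Proof.
case: t => //= -[x y] t; rewrite /path_arcs /=.
elim: t x y => //= -[y' z] t IHt x y /= /andP[/andP[/= /eqP<- _] pt].
by rewrite IHt.
Qed.

Lemma sorted_verts t : all (mem (arcs D)) t -> sorted follows t -> sorted D (verts t).
Proof.
case: t => //= -[x y] t /andP[/=]; rewrite inE /= => -> /=.
elim: t x y => //= -[y' z] t IHt x y /= /andP[+ arcst] /andP[/andP[/= /eqP-> _] pt].
by rewrite inE /= => -> /=; apply: IHt pt.
Qed.

Lemma family_arcs ts t : trail_family ts -> t \in ts -> all (mem (arcs D)) t.
Proof.
case/andP=> _ /perm_mem eqm tts; apply/allP=> a at_.
by have := eqm a; rewrite mem_enum /= => <-; apply/flattenP; exists t.
Qed.

Lemma family_trail ts t : trail_family ts -> t \in ts -> (t != [::]) && sorted follows t.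
Proof. by case/andP=> /allP h _; apply: h. Qed.

Lemma family_uniq ts t : trail_family ts -> t \in ts -> uniq t.
Proof.
case/andP=> _ /perm_uniq uf tts.
have : uniq (flatten ts) by rewrite uf enum_uniq.
rewrite (perm_uniq (perm_flatten (perm_to_rem tts))) /= cat_uniq.
by case/and3P.
Qed.

Lemma family_disjoint ts t t' a : trail_family ts -> t \in ts -> t' \in ts ->
  a \in t -> a \in t' -> t = t'.
Proof.
case/andP=> _ /perm_uniq uf tts t'ts at_ at'; apply/eqP/negPn/negP=> tt'.
have : uniq (flatten ts) by rewrite uf enum_uniq.
rewrite (perm_uniq (perm_flatten (perm_to_rem tts))) /= cat_uniq.
case/and3P=> _ /hasPn/(_ a)/= h _; have := h _; rewrite at_ => /(_ _)/negP; apply=> //.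
apply/flattenP; exists t' => //.
have := perm_mem (perm_to_rem tts) t'; rewrite t'ts inE eq_sym (negPf tt') /= => <- //.
Qed.

Lemma merge_family ts t t' a b : trail_family ts ->
  rcons t a \in ts -> b :: t' \in ts -> follows a b ->
  exists ts', trail_family ts' /\ size ts' < size ts.
Proof.
move=> fam tin tin' ab.
(* A trail followed by itself would return to its first vertex, against [trail_uniq]. *)
have neq : rcons t a != b :: t'.
  apply/eqP=> eqt; have /andP[_ st] := family_trail fam tin.
  have := trail_uniq (family_arcs fam tin) st.
  move: ab => /andP[/eqP ab _]; rewrite eqt.
  change (uniq (b.1 :: map snd (b :: t')) -> False).
  by rewrite -eqt map_rcons /= mem_rcons inE ab eqxx.
have tin'' : b :: t' \in rem (rcons t a) ts.
  by have := perm_mem (perm_to_rem tin) (b :: t'); rewrite tin' inE eq_sym (negPf neq) /= => <-.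
have pts : perm_eq ts [:: rcons t a, b :: t' & rem (b :: t') (rem (rcons t a) ts)].
  by apply: perm_trans (perm_to_rem tin) _; rewrite perm_cons perm_to_rem.
exists ((rcons t a ++ b :: t') :: rem (b :: t') (rem (rcons t a) ts)).
split; last by rewrite (perm_size pts).
move: fam; rewrite /trail_family (perm_all _ pts) => /andP[/= /and3P[st st' ->]].
rewrite (permPl (perm_flatten pts)) /= -catA => ->; rewrite andbT andbT.
rewrite cat_rcons; move: st' => /= st'; case/andP: st => _.
case: t {tin neq tin'' pts} => [|c t] /=; first by rewrite ab st'.
by rewrite rcons_path cat_path /= ab st' andbT => /andP[-> ->].
Qed.

(** Start from single arcs and merge; each merge lowers the number of trails. *)
Lemma unmergeable_family : exists ts, trail_family ts /\ ~ mergeable ts.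
Proof.
have ind n ts : size ts < n -> trail_family ts -> exists ts', trail_family ts' /\ ~ mergeable ts'.
  elim: n ts => // n IHn ts; rewrite ltnS => szn fam.
  have [[t [t' [a [b [tin tin' ab]]]]]|] := pselect (mergeable ts); last by exists ts.
  have [ts' [fam' lt]] := merge_family fam tin tin' ab.
  by apply: IHn fam'; apply: leq_trans lt szn.
apply: (ind _ [seq [:: a] | a <- enum (arcs D)] (ltnSn _)); apply/andP; split.
  by apply/allP=> _ /mapP[a _ ->].
by rewrite (_ : flatten _ = enum (arcs D)) //; elim: (enum _) => //= a s ->.
Qed.

(** Otherwise saturation gives [a] or [b] a partner there. A partner of [a] cannot begin a trail, as
    that trail could be merged; its predecessor is then [a] by [mate_inj], yet [a] ends its own
    trail. The case of [b] is symmetric. *)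
Lemma unmergeable_ends ts t t' a b : trail_family ts -> ~ mergeable ts ->
  rcons t a \in ts -> b :: t' \in ts -> a.2 <> b.1.
Proof.
move=> fam nm tin tin' ab.
have inD t0 c : t0 \in ts -> c \in t0 -> D c.1 c.2.
  by move=> /(family_arcs fam)/allP h /h; rewrite !inE.
have inT c : D c.1 c.2 -> exists2 t0, t0 \in ts & c \in t0.
  move=> Dc; have : c \in flatten ts.
    by case/andP: fam => _ /perm_mem->; rewrite mem_enum inE.
  by case/flattenP=> t0; exists t0.
have Da : D a.1 a.2 by apply: inD tin _; rewrite mem_rcons mem_head.
have Db : D a.2 b.2 by rewrite ab; apply: inD tin' _; rewrite mem_head.
have [[w mw]|[u mu]] := mate_saturated Da Db.
  have /andP[_ Dw] := mate_arc mw.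
  have [t0 t0in c_t0] := @inT (a.2, w) Dw.
  have [s1 [s2 def_t0]] : exists s1 s2, t0 = s1 ++ (a.2, w) :: s2.
    by case/splitPr: c_t0 => s1 s2; exists s1, s2.
  rewrite {}def_t0 in t0in c_t0.
  case/lastP: s1 t0in c_t0 => [|s1 c] t0in c_t0.
    by apply: nm; exists t, s2, a, (a.2, w); rewrite /follows /= eqxx.
  rewrite cat_rcons in t0in.
  have /andP[_ st0] := family_trail fam t0in.
  have /andP[/eqP/= c2 mc] := sorted_adjacent st0.
  have ca : c = a.
    by apply/eqP; rewrite -pair_eqE /pair_eq c2 eqxx andbT (mate_inj mw (u' := c.1)) // -c2.
  rewrite ca in t0in; apply: (uniq_last_adjacent (family_uniq fam tin)).
  apply: (family_disjoint (a := a) fam tin t0in).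
    by rewrite mem_rcons mem_head.
  by rewrite mem_cat mem_head orbT.
have /andP[Du _] := mate_arc mu.
have [t0 t0in c_t0] := @inT (u, a.2) Du.
have [s1 [s2 def_t0]] : exists s1 s2, t0 = s1 ++ (u, a.2) :: s2.
  by case/splitPr: c_t0 => s1 s2; exists s1, s2.
rewrite {}def_t0 in t0in c_t0.
case: s2 t0in c_t0 => [|c s2] t0in c_t0.
  apply: nm; exists s1, t', (u, a.2), b; rewrite -cats1; split=> //.
  by rewrite /follows /= ab eqxx -ab.
have /andP[_ st0] := family_trail fam t0in.
have /andP[/eqP/= c1 mc] := sorted_adjacent st0.
have cb : c = b.
  by apply/eqP; rewrite -pair_eqE /pair_eq -c1 ab eqxx (mate_fun mu mc) eqxx.
rewrite cb in t0in; apply: (uniq_head_adjacent (family_uniq fam tin')).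
apply: (family_disjoint (a := b) fam tin' t0in); first exact: mem_head.
by rewrite mem_cat !inE eqxx !orbT.
Qed.

Lemma trail_partition : exists ps, path_partition D ps /\
  forall v, starts ps v = 0 \/ ends ps v = 0.
Proof.
have [ts [fam nm]] := unmergeable_family.
exists (map verts ts); split.
  apply/andP; split.
    apply/allP=> _ /mapP[t tts ->]; have /andP[tn st] := family_trail fam tts.
    have at_ := family_arcs fam tts.
    by rewrite /dipath trail_uniq // sorted_verts // !andbT; case: t tn {tts st at_}.
  have -> : map (@path_arcs T) (map verts ts) = ts; last by case/andP: fam.
  rewrite -map_comp -[RHS]map_id; apply/eq_in_map => t tts /=.
  by rewrite path_arcs_verts //; case/andP: (family_trail fam tts).
move=> v; have [s0|s0] := posnP (starts (map verts ts) v); first by left.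
have [e0|e0] := posnP (ends (map verts ts) v); first by right.
move: s0 e0; rewrite -!has_count.
move=> /hasP[_ /mapP[t' t'in ->] /eqP hv] /hasP[_ /mapP[t tin ->] /eqP lv].
have /andP[t'n _] := family_trail fam t'in; have /andP[tn _] := family_trail fam tin.
case: t' t'n t'in hv => // b t' _ t'in /= hv.
case/lastP: t tn tin lv => // t a _ tin lv.
case: (unmergeable_ends fam nm tin t'in); rewrite hv -lv.
case: t {tin lv} => [|c t] //=.
by rewrite map_rcons last_rcons.
Qed.
End Trails.

(** * Cycles in orientations, and the conclusion *)

Lemma girth_le (T : finType) (G : sgraph T) (g : nat) (c : seq T) :
  (g%:Z%:E <= girth G)%E -> 2 < size c -> uniq c -> cycle G c -> g <= size c.
Proof.
move=> gG c2 uc cc.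
have cyc : has_cycle G (size c).
  by rewrite /has_cycle c2; apply/existsP; exists (in_tuple c); rewrite /ucycleb cc.
move: gG; rewrite /girth; case: pselect => [ex|[]]; last by exists (size c).
by case: ex_minnP => m _ /(_ _ cyc) mc; rewrite lee_fin lez_nat => /leq_trans; apply.
Qed.

Section Orientation.
Variables (T : finType) (G : sgraph T) (D : digraph T) (d : nat).
Hypothesis ori : orientation G D.

Lemma cycle_orientation_size (c : seq T) : c != [::] -> cycle D c -> 2 < size c.
Proof.
case: c => [|x [|y [|z c]]] //= _; rewrite ?andbT ?arc_irr //.
by move=> /andP[xy yx]; have [_] := ori x y; rewrite xy yx.
Qed.

Lemma cycle_orientation (c : seq T) : cycle D c -> cycle G c.
Proof. by apply: sub_cycle => x y Dxy; have [-> _] := ori x y; rewrite Dxy. Qed.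

Lemma size_ins_outs v : regular G d -> size (ins D v) + size (outs D v) = d.
Proof.
move=> /(_ v) <-; rewrite -!cardE.
rewrite -cardUI [X in _ + X](_ : _ = 0) ?addn0.
  apply: eq_card => y; rewrite !inE; have [-> _] := ori v y.
  by rewrite orbC.
by apply: eq_card0 => y; rewrite !inE; have [_ /negPf] := ori v y; rewrite andbC.
Qed.

End Orientation.

Section TrailsArePaths.
Variables (T : finType) (D : digraph T) (mate : T -> rel T).
Hypothesis no_bad : forall y r, uniq y -> cycle D y -> r \in y ->
  exists x, [/\ x \in y, x != r & ~~ mate x (prev y x) (next y x)].

Lemma follows_nth a t x0 i : path (follows mate) a t -> i < size t ->
  let p := verts (a :: t) in mate (nth x0 p i.+1) (nth x0 p i) (nth x0 p i.+2).
Proof.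
elim: t a i => // -[b c] t IHt [x y] [|i] /= /andP[/andP[/= /eqP <- m] pt] it //.
exact: (IHt (y, c) i pt it).
Qed.

(** By induction on the trail only its first vertex can recur; the part up to the recurrence is a
    cycle matched everywhere but there, against [no_bad]. *)
Lemma mated_trail_uniq t : all (mem (arcs D)) t -> sorted (follows mate) t ->
  uniq (verts t).
Proof.
case: t => // a t; elim: t a => [|b t IHt] a arcsT trailT.
  move: arcsT; rewrite /= andbT inE => Da; rewrite inE andbT.
  by apply: contraTneq Da => ->; rewrite arc_irr.
set p := map snd [:: a, b & t].
have up : uniq p.
  move: (arcsT) (trailT) => /andP[_ arcsT'] /andP[/andP[/eqP ab _] trailT'].
  by have := IHt b arcsT' trailT'; rewrite /p /= -ab.
have pD : path D a.1 p by have := sorted_verts arcsT trailT.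
have mN i : i < size (b :: t) ->
    mate (nth a.1 p i) (nth a.1 (a.1 :: p) i) (nth a.1 p i.+1).
  by move=> it; have := @follows_nth a (b :: t) a.1 i trailT it.
have sp : size p = (size (b :: t)).+1 by rewrite size_map.
change (uniq (a.1 :: p)); clearbody p; rewrite cons_uniq up andbT; apply/negP => xp.
have [p1 [p2 def_p]] : exists p1 p2, p = p1 ++ a.1 :: p2.
  by case/splitPr: xp => p1 p2; exists p1, p2.
rewrite {}def_p {xp} in sp pD up mN.
have uy : uniq (a.1 :: p1).
  by move: up; rewrite -cat_rcons cat_uniq rcons_uniq => /andP[].
have cy : cycle D (a.1 :: p1).
  by move: pD; rewrite /= -cat_rcons cat_path => /andP[].
have [z [zy zx /negP]] := no_bad uy cy (mem_head _ _); apply.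
have zp1 : z \in p1 by move: zy; rewrite inE (negPf zx).
have ip : index z p1 < size p1 by rewrite index_mem.
rewrite next_nth prev_nth zy /= ifN 1?eq_sym //.
have := mN (index z p1); rewrite {1}nth_cat ip nth_index //.
have -> : nth a.1 (a.1 :: p1 ++ a.1 :: p2) (index z p1) = nth a.1 (a.1 :: p1) (index z p1).
  by rewrite -cat_cons nth_cat /= ltnS ltnW.
(* If [z] ends [p1], the default [a.1] is both its cyclic successor and the next vertex of the
   trail. *)
have -> : nth a.1 (p1 ++ a.1 :: p2) (index z p1).+1 = nth a.1 p1 (index z p1).+1.
  rewrite nth_cat; case: ltnP => // ge; rewrite (nth_default _ ge).
  by rewrite (_ : _ - _ = 0) //; apply/eqP; rewrite subn_eq0.
by apply; move: sp; rewrite size_cat /=; lia.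
Qed.
End TrailsArePaths.

Theorem theorem1p4 (d : nat) (T : finType) (G : sgraph T)
  (d_odd : odd d)
  (G_regular : regular G d)
  (G_girth : (((200 * d ^ 2)%N%:Z)%:E <= girth G)%E) :
  strongly_consistent G.
Proof.
move=> D ori.
have d0 : 0 < d by case: d d_odd {G_regular G_girth}.
have deg v := size_ins_outs ori v G_regular.
have k_bnd v : 0 < degmax D v <= d.
  by rewrite /degmax; have := deg v; lia.
(* The factorial of [d] serves as a common multiple of all [degmax D v]. *)
have k_dvd v : degmax D v %| d`! by rewrite dvdn_fact.
have [||v|v|f gf] := @good_configuration T 'I_(d`!) d (degmax D) _ d0 k_bnd D
  (fun v => @shift_mate _ D d`! v).
- by rewrite card_ord fact_gt0.
- move=> v u w; rewrite card_ord; apply: shift_mate_card => //.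
  by case/andP: (k_bnd v).
- by rewrite cardE leq_maxr.
(* The two degrees sum to the odd [d], so they cannot both equal [degmax D v]. *)
- rewrite !cardE -/(ins D v) -/(outs D v) /degmax.
  by have := deg v; case: eqP; lia.
have [|||||ps [part noth]] := @trail_partition T D (fun v => shift_mate D v (f v)).
- by move=> v u w /and3P[-> ->].
- by move=> v u w w'; apply: shift_mate_fun.
- by move=> v u u' w; apply: shift_mate_inj.
- by move=> v u w; apply: shift_mate_saturated.
- apply: mated_trail_uniq => y r uy cy ry; apply: gf => //.
  apply: (girth_le G_girth) => //; last exact: cycle_orientation cy.
  by apply: (cycle_orientation_size ori _ cy); case: y ry {uy cy}.
exact: consistent_witness part noth.
Qed.
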